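(* Let $v\geq2$, let $W$ be a $\operatorname{BGW}(v,d,\lambda)$, and let $A=\begin{bmatrix}O&W\\ W^{\top}&O\end{bmatrix}$. Then, for each $a\in\{0,1\}$, the hypergraph $\mathfrak H_A(2v,4,a)$ is a $\operatorname{PBIBD}(2v,4;\lambda_1^{(a)},\lambda_2^{(a)},\lambda_3^{(a)})$ on $\mathcal X_2$, where $$\lambda_1^{(a)}=(1-a)\left(\binom{2v}{4}-\frac{\lambda(d-1)}{2}\right)+(2a-1)\bigl(d^2+d(v-2)-2\lambda(d-1)\bigr),$$ $$\lambda_2^{(a)}=(1-a)\left(\binom{2v}{4}-\frac{\lambda^2}{4}\right)+(2a-1)(d^2-\lambda^2),$$ $$\lambda_3^{(a)}=(1-a)\binom{2v}{4}+(2a-1)d^2.$$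
   Context: For positive integers $t,v,k,\lambda$, a $t$-$(v,k,\lambda)$ design (or $t$-design) is a $k$-uniform hypergraph on a $v$-element vertex set such that any set of $t$ vertices appear together in precisely $\lambda$ hyperedges. A $2$-design is symmetric if its number of hyperedges equals its number of vertices. The incidence matrix $N$ of a hypergraph is the $\{0,1\}$-matrix with rows indexed by vertices and columns by hyperedges, with $N_{x,b}=1$ iff $x\in b$. A balanced generalised weighing matrix $\operatorname{BGW}(v,d,\lambda)$ is a $v\times v$ $\{0,\pm1\}$-matrix $W$ with $WW^{\top}=dI$ such that the matrix $N$ obtained from $W$ by replacing $-1$ with $1$ is the incidence matrix of a symmetric $2$-$(v,d,\lambda)$ design. $\mathcal X_2=([2v],\{R_i\}_{i=0}^3)$ is the $3$-class symmetric association scheme on $[2v]=\{1,\dots,2v\}$ with $(x,y)\in R_i$ iff $(A_i)_{xy}=1$, where $A_0=I_{2v}$, $A_1=\begin{bmatrix}O & N \\ N^{\top} & O\end{bmatrix}$, $A_2=I_2\otimes(J_v-I_v)$, $A_3=\begin{bmatrix}O & J-N \\ J-N^{\top} & O\end{bmatrix}$; here $J$ is the all-ones matrix and $O$ the zero matrix. For an $m\times m$ matrix $A$, $\mathfrak H_A(m,k,a)$ is the $k$-uniform hypergraph on $[m]=\{1,\dots,m\}$ whose hyperedges are the $k$-subsets $\alpha\subset[m]$ with $\det(A[\alpha])=a$, where $A[\alpha]$ is the principal submatrix of $A$ indexed by $\alpha$. A $\operatorname{PBIBD}(m,k;\lambda_1,\lambda_2,\lambda_3)$ (partially balanced incomplete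 block design) on a symmetric association scheme $([m],\{R_i\}_{i=0}^3)$ is a $k$-uniform $1$-design on $[m]$ such that, for each $i\in\{1,2,3\}$ and each $(x,y)\in R_i$, the pair $\{x,y\}$ is contained in exactly $\lambda_i$ hyperedges.
   Formalization: In all three formulas the binomial (2v choose 4) is replaced by (2v−2 choose 2), the number of 4-subsets containing a given pair; as printed, the case a = 0 is false for every v ≥ 3 (e.g. BGW(4,3,2): printed λ_2 = 64, but only 15 four-subsets contain a pair). *)

(* Defs.v *)
From mathcomp Require Import all_boot all_order all_algebra.

Set Implicit Arguments.
Unset Strict Implicit.
Unset Printing Implicit Defensive.

Import Order.TTheory GRing.Theory Num.Theory.
Local Open Scope ring_scope.

(* Hyperedges are listed with multiplicity, so a symmetric design may have
   repeated hyperedges; this happens exactly when N = J (W Hadamard).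
   lam = 0 is allowed here; positivity is imposed in [is_BGW]. *)
Definition is_design (V : finType) (t k lam : nat) (E : seq {set V}) : Prop :=
  (forall e, e \in E -> #|e| = k) /\
  (forall S : {set V}, #|S| = t -> count (fun e : {set V} => S \subset e) E = lam).

Definition incidence_mx (v n : nat) (E : n.-tuple {set 'I_v}) : 'M[int]_(v, n) :=
  \matrix_(x, b) (x \in tnth E b)%:R.

Definition unsign_mx (v : nat) (W : 'M[int]_v) : 'M[int]_v :=
  map_mx (fun w => if w == -1 then 1 else w) W.

Definition is_BGW (v d lam : nat) (W : 'M[int]_v) : Prop :=
  [/\ (0 < d)%N && (0 < lam)%N,
      forall x y, W x y \in [:: 0; 1; -1],
      W *m W^T = d%:R%:M &
      exists2 E : v.-tuple {set 'I_v},
        is_design 2 d lam E & unsign_mx W = incidence_mx E].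

(* Relations are allowed to be empty: R_3 of [X2] is empty when N = J. *)
Definition is_symmetric_scheme (m c : nat) (R : 'I_c.+1 -> rel 'I_m) : Prop :=
  [/\ forall x y, R ord0 x y = (x == y),
      forall x y, exists! i, R i x y,
      forall i, symmetric (R i) &
      exists p : 'I_c.+1 -> 'I_c.+1 -> 'I_c.+1 -> nat,
        forall i j k x y, R k x y ->
          #|[set z | R i x z && R j z y]| = p i j k].

Definition X2_mx (v : nat) (N : 'M[int]_v) (i : 'I_4) : 'M[int]_(v + v) :=
  let J : 'M[int]_v := const_mx 1 in
  nth 0 [:: 1%:M;
            block_mx 0 N N^T 0;
            block_mx (J - 1%:M) 0 0 (J - 1%:M);
            block_mx 0 (J - N) (J - N^T) 0] i.

Definition X2 (v : nat) (N : 'M[int]_v) (i : 'I_4) : rel 'I_(v + v) :=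
  fun x y => X2_mx N i x y == 1.

Definition principal_submx (R : Type) (m : nat) (A : 'M[R]_m)
    (alpha : {set 'I_m}) : 'M[R]_#|alpha| :=
  mxsub (@enum_val _ (mem alpha)) (@enum_val _ (mem alpha)) A.

Definition det_hypergraph (R : comNzRingType) (m : nat) (A : 'M[R]_m)
    (k : nat) (a : R) : {set {set 'I_m}} :=
  [set alpha : {set 'I_m} | (#|alpha| == k) && (\det (principal_submx A alpha) == a)].

(* The parameters are rational because they are given by formulas with
   denominators, and because a parameter attached to an empty relation is
   unconstrained (the formulas can be negative there). *)
Definition is_PBIBD (m k : nat) (lam1 lam2 lam3 : rat)
    (R : 'I_4 -> rel 'I_m) (H : {set {set 'I_m}}) : Prop :=
  [/\ is_symmetric_scheme R,
      exists r, is_design 1 k r (enum H) &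
      forall (i : 'I_3) x y, R (lift ord0 i) x y ->
        #|[set e in H | [set x; y] \subset e]|%:R
          = nth 0 [:: lam1; lam2; lam3] i].

(* Main.v *)
(* A symmetric 4 x 4 matrix with zero diagonal has determinant
   P^2 + Q^2 + S^2 - 2 (PQ + PS + QS), where P, Q, S are the products over the
   three perfect matchings.  On the bipartite matrix A this is the square of a
   2 x 2 minor of W when two indices lie on each side, and 0 otherwise, so it
   is 0, 1 or 4.  The hyperedges through {s, t} are counted, twice, by the
   ordered pairs (z, w) completing it.  For p, q in {0, 1, -1}, the indicator
   of (p - q)^2 = 1 is p^2 + q^2 - 2 p^2 q^2, and that of (p - q)^2 = 4 is
   (p^2 q^2 - p q) / 2; these polynomials are summed with the orthogonality
   relations of W and of its entrywise square N, and the determinant 0 is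
   obtained by complement.  The dual relations, for W^T W and N^T N, hold because
   a symmetric integer matrix M with zero diagonal and M^2 = c M vanishes. *)

Require Import Defs.
From mathcomp Require Import all_boot all_order all_fingroup all_algebra.
From mathcomp Require Import zify ring lra.

Set Implicit Arguments.
Unset Strict Implicit.
Unset Printing Implicit Defensive.

Import Order.TTheory GRing.Theory Num.Theory.
Local Open Scope ring_scope.

(** * Principal minors and the determinant of a hollow symmetric 4 x 4 matrix *)

(** The enumeration of [alpha] and [f] differ by one permutation, applied to rows and columns alike,
    so its sign occurs twice and cancels. This allows the four indices to be listed in any
    convenient order. *)
Lemma principal_submx_det (R : comNzRingType) (m n : nat) (A : 'M[R]_m)
    (alpha : {set 'I_m}) (f : 'I_n -> 'I_m) :
  injective f -> f @: setT = alpha ->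
  \det (principal_submx A alpha) = \det (mxsub f f A).
Proof.
move=> f_inj f_im.
have alpha_n : n = #|alpha| by rewrite -f_im card_imset // cardsT card_ord.
move: f f_inj f_im; rewrite alpha_n => f f_inj f_im.
have f_alpha i : f i \in alpha by rewrite -f_im imset_f.
pose h i := enum_rank_in (f_alpha i) (f i).
have hK i : enum_val (h i) = f i by rewrite enum_rankK_in.
have h_inj : injective h by move=> i j /(congr1 enum_val); rewrite !hK => /f_inj.
have -> : mxsub f f A
          = row_perm (perm h_inj) (col_perm (perm h_inj) (principal_submx A alpha)).
  by apply/matrixP => i j; rewrite !mxE !permE !hK.
rewrite row_permE col_permE !det_mulmx !det_perm mulrC -mulrA.
by rewrite odd_permV -signr_addb addbb mulr1.
Qed.

(* Entries are indexed by nat, so that minors of concrete size compute. *)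
Lemma det_expand_nat (R : comNzRingType) n (g : nat -> nat -> R) :
  \det (\matrix_(i < n.+1, j < n.+1) g i j)
  = \sum_(j < n.+1)
      g 0%N j * ((-1) ^+ j * \det (\matrix_(i < n, k < n) g i.+1 (bump j k))).
Proof.
rewrite (expand_det_row _ ord0); apply: eq_bigr => j _.
rewrite mxE /cofactor add0n; congr (_ * (_ * \det _)).
by apply/matrixP => i k; rewrite !mxE lift0.
Qed.

Lemma det_nat2 (R : comNzRingType) (g : nat -> nat -> R) :
  \det (\matrix_(i < 2, j < 2) g i j)
  = g 0%N 0%N * g 1%N 1%N - g 0%N 1%N * g 1%N 0%N :> R.
Proof.
rewrite det_expand_nat !big_ord_recl big_ord0 !det_mx11 !mxE /bump /=.
rewrite expr0 expr1; ring.
Qed.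

Lemma det_nat3 (R : comNzRingType) (g : nat -> nat -> R) :
  \det (\matrix_(i < 3, j < 3) g i j)
  = g 0%N 0%N * (g 1%N 1%N * g 2%N 2%N - g 1%N 2%N * g 2%N 1%N)
    - g 0%N 1%N * (g 1%N 0%N * g 2%N 2%N - g 1%N 2%N * g 2%N 0%N)
    + g 0%N 2%N * (g 1%N 0%N * g 2%N 1%N - g 1%N 1%N * g 2%N 0%N) :> R.
Proof.
rewrite det_expand_nat !big_ord_recl big_ord0.
rewrite !(det_nat2 (fun i k => g i.+1 (bump _ k))) /bump /= expr0 expr1 sqrrN expr1n.
ring.
Qed.

Definition hollow_det4 (R : comNzRingType) (m : nat) (A : 'M[R]_m) s t z w : R :=
  let P := A s t * A z w in let Q := A s z * A t w in let S := A s w * A t z in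
  P ^+ 2 + Q ^+ 2 + S ^+ 2 - 2 * (P * Q + P * S + Q * S).

Lemma det_hollow4 (R : comNzRingType) (m : nat) (A : 'M[R]_m) s t z w :
  A^T = A -> (forall i, A i i = 0) -> uniq [:: s; t; z; w] ->
  \det (principal_submx A [set s; t; z; w]) = hollow_det4 A s t z w.
Proof.
move=> A_sym A_hollow stzw.
have AC i j : A i j = A j i by rewrite -{1}A_sym mxE.
rewrite (@principal_submx_det R m 4 A _ (tnth [tuple s; t; z; w])).
- pose g i j := A (nth s [:: s; t; z; w] i) (nth s [:: s; t; z; w] j).
  have -> : mxsub (tnth [tuple s; t; z; w]) (tnth [tuple s; t; z; w]) A
            = \matrix_(i < 4, j < 4) g i j.
    by apply/matrixP => i j; rewrite !mxE !(tnth_nth s).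
  rewrite det_expand_nat !big_ord_recl big_ord0.
  rewrite !(det_nat3 (fun i k => g i.+1 (bump _ k))) /bump /g /= !A_hollow.
  rewrite (AC t s) (AC z s) (AC w s) (AC z t) (AC w t) (AC w z) /hollow_det4 /=.
  rewrite /bump /= expr0 expr1 -signr_odd -[in _ ^+ (1 + (1 + _))]signr_odd /= expr0 expr1.
  ring.
- by apply/tuple_uniqP.
- apply/setP => i; rewrite !inE; apply/imsetP/idP => [[j _ ->]|].
    by have := mem_tnth j [tuple s; t; z; w]; rewrite !inE !orbA.
  rewrite -!orbA => hi.
  have /tnthP[j ->] : i \in [tuple s; t; z; w] by rewrite !inE.
  by exists j; rewrite ?inE.
Qed.

(** A repeated index puts a diagonal entry into one matching product, which vanishes, and makes the
    other two equal; what remains is Q^2 + Q^2 - 2 Q^2. Hence sums over (z, w) that test for a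
    nonzero value need no distinctness condition. *)
Lemma hollow_det4_repeat (R : comNzRingType) (m : nat) (A : 'M[R]_m) s t z w :
  A^T = A -> (forall i, A i i = 0) -> ~~ uniq [:: s; t; z; w] ->
  hollow_det4 A s t z w = 0.
Proof.
move=> A_sym A_hollow.
have AC i j : A i j = A j i by rewrite -{1}A_sym mxE.
rewrite /= !inE !andbT !negb_and !negb_or !negb_and !negbK /hollow_det4.
move=> H; have : [|| s == t, s == z, s == w, t == z, t == w | z == w] by lia.
do 5?[case/orP]; move=> /eqP ->; rewrite ?A_hollow.
- ring.
- rewrite (AC t z); ring.
- rewrite (AC t w) (AC z w); ring.
- ring.
- rewrite (AC z w); ring.
- ring.
Qed.

(** * Counting 4-subsets through a pair *)

Lemma card_4sets_through_pair (T : finType) (P : pred {set T}) (s t : T) :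
  s != t ->
  (2 * #|[set e : {set T} | [&& #|e| == 4, P e & [set s; t] \subset e]]|)%N
  = #|[set zw : T * T | uniq [:: s; t; zw.1; zw.2] && P [set s; t; zw.1; zw.2]]|.
Proof.
move=> st.
set E := [set e | _]; set Z := [set zw | _].
pose join zw : {set T} := [set s; t; zw.1; zw.2].
have join_E zw : zw \in Z -> join zw \in E.
  rewrite !inE => /andP[u Pz]; rewrite Pz /=; apply/andP; split.
    rewrite /join.
    have -> : [set s; t; zw.1; zw.2]
              = [set:: [:: s; t; zw.1; zw.2]].
      by apply/setP => i; rewrite !inE !orbA.
    by rewrite cardsE (card_uniqP u).
  by rewrite /join -setUA subsetUl.
rewrite -[#|Z|]sum1_card (partition_big join (mem E)) //=.
rewrite (eq_bigr (fun=> 2%N)) => [|e]; first by rewrite sum_nat_const mulnC.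
 rewrite inE => /and3P[/eqP e4 Pe ste].
have : #|e :\: [set s; t]| == 2%N.
  by rewrite cardsD (setIidPr ste) e4 cards2 st.
case/cards2P => z; case=> w; case=> zw ezw.
have e_join : e = [set s; t] :|: [set z; w].
  by rewrite -ezw setUC setDE setUIl (setUidPl ste) [~: _ :|: _]setUC setUCr setIT.
have zE : z \in e :\: [set s; t] by rewrite ezw !inE eqxx.
have wE : w \in e :\: [set s; t] by rewrite ezw !inE eqxx orbT.
(* The fibre of [join] over [e] consists of the two orderings of [e :\: [set s; t]]. *)
transitivity #|[set (z, w); (w, z)]|; last first.
  by rewrite cards2 xpair_eqE (eq_sym w) andbb zw.
rewrite sum1_card.
apply: eq_card => -[z' w']; rewrite -[LHS]topredE /= !inE !xpair_eqE /=.
apply/idP/idP => [/andP[/andP[u _] /eqP e_z'w']|].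
  have : z' \in [set z; w] /\ w' \in [set z; w].
    rewrite -ezw -e_z'w'; move: u; rewrite /= !inE !eqxx !orbT !andbT !negb_or.
    by rewrite -!(eq_sym z') -!(eq_sym w') => /andP[/and3P[_ -> ->]] /andP[/andP[-> ->]].
  move: u; rewrite /= !inE !andbT => /and3P[_ _ z'w'].
  by move=> [/orP[]/eqP ? /orP[]/eqP ?]; subst z' w'; rewrite !eqxx ?orbT in z'w' *.
move: zE wE; rewrite !inE !negb_or => /andP[/andP[zs zt] _] /andP[/andP[ws wt] _].
case/orP=> /andP[/eqP -> /eqP ->].
  rewrite -setUA -e_join Pe /join /= -setUA -e_join eqxx.
  by rewrite st !(eq_sym s) !(eq_sym t) zs zt ws wt zw.
rewrite -setUA [[set w] :|: _]setUC -e_join Pe /join /= -setUA.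
rewrite [[set w] :|: _]setUC -e_join eqxx.
by rewrite st !(eq_sym s) !(eq_sym t) (eq_sym w z) zs zt ws wt zw.
Qed.

Definition edges_through (m : nat) (A : 'M[int]_m) (a : int) (s t : 'I_m) : nat :=
  #|[set e in det_hypergraph A 4 a | [set s; t] \subset e]|.

Lemma edges_throughC m (A : 'M[int]_m) a s t :
  edges_through A a s t = edges_through A a t s.
Proof. by rewrite /edges_through setUC. Qed.

Lemma edges_through_hollow m (A : 'M[int]_m) (a : int) s t :
  A^T = A -> (forall i, A i i = 0) -> a != 0 -> s != t ->
  2 * (edges_through A a s t)%:R
  = \sum_z \sum_w (hollow_det4 A s t z w == a)%:R :> int.
Proof.
move=> A_sym A_hollow a0 st.
rewrite -natrM (_ : edges_through A a s t = #|[set e : {set 'I_m} |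
    [&& #|e| == 4, \det (principal_submx A e) == a & [set s; t] \subset e]]|).
  rewrite card_4sets_through_pair // pair_big /= -natr_sum -sum1dep_card big_mkcond /=.
  congr _%:R; apply: eq_bigr => -[z w] _ /=.
  rewrite -[X in X && _]/(uniq [:: s; t; z; w]); have [u|u] := boolP (uniq _).
    by rewrite andTb det_hollow4 //; case: (_ == a).
  by rewrite hollow_det4_repeat // [0 == a]eq_sym (negPf a0).
by apply: eq_card => e; rewrite !inE andbA.
Qed.

Lemma card_supersets (T : finType) (S : {set T}) k :
  #|[set e : {set T} | (#|e| == #|S| + k)%N && (S \subset e)]| = 'C(#|T| - #|S|, k).
Proof.
rewrite -(cardsC S) addKn -cards_draws -[RHS](card_in_imset (f := fun B => S :|: B)).
  apply: eq_card => e; rewrite !inE; apply/andP/imsetP => [[/eqP e_k Se]|[B]].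
    exists (e :\: S); first by rewrite inE cardsD (setIidPr Se) e_k addKn setDE subsetIr /=.
    by rewrite setDE setUIr setUCr setIT; apply/esym/setUidPr.
  rewrite inE => /andP[BS /eqP <-] ->; rewrite subsetUl cardsU.
  by rewrite setIC (eqP (_ : B :&: S == set0)) ?cards0 ?subn0 ?setI_eq0 ?disjoints_subset.
have setUSK (B : {set T}) : B \in [set A : {set T} | A \subset ~: S & #|A| == k] -> (S :|: B) :\: S = B.
  rewrite inE => /andP[BS _]; rewrite setDE setIUl setICr set0U.
  exact/setIidPl.
by move=> B C /setUSK BK /setUSK CK BC; rewrite -BK BC CK.
Qed.

(** Every 4-set through the pair is counted under exactly one value. This is the route to
    determinant 0, which the sums over (z, w) cannot isolate because repeated indices also give
    0. *)
Lemma edges_through_total m (A : 'M[int]_m) (vals : seq int) s t :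
  A^T = A -> (forall i, A i i = 0) -> s != t -> uniq vals ->
  (forall z w, hollow_det4 A s t z w \in vals) ->
  (\sum_(a <- vals) edges_through A a s t)%N = 'C(m - 2, 2).
Proof.
move=> A_sym A_hollow st vals_uniq vals_det.
have -> : 'C(m - 2, 2) = #|[set e : {set 'I_m} | (#|e| == 4) && ([set s; t] \subset e)]|.
  have := card_supersets [set s; t] 2.
  by rewrite card_ord cards2 st.
(* [vals_det] bounds the formula on tuples. To transfer it to sets, the 4-sets whose determinant
   lies outside [vals] are counted by ordered pairs, of which there are none. *)
have det_vals (e : {set 'I_m}) : #|e| == 4%N -> [set s; t] \subset e ->
    \det (principal_submx A e) \in vals.
  move=> e4 ste; apply/negPn/negP => e_vals.
  have := @card_4sets_through_pair _ [pred e | \det (principal_submx A e) \notin vals] s t st.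
  rewrite [RHS](_ : _ = 0%N).
    move/eqP; rewrite muln_eq0 cards_eq0 /= => /eqP/setP/(_ e).
    by rewrite !inE e4 e_vals ste.
  apply/eqP; rewrite cards_eq0; apply/eqP/setP => -[z w]; rewrite !inE.
  apply/negP => /andP[u /=]; rewrite det_hollow4 //; first by rewrite vals_det.
under eq_bigr do rewrite /edges_through -sum1dep_card big_mkcond /=.
rewrite exchange_big /= -sum1dep_card [RHS]big_mkcond /=; apply: eq_bigr => e _.
have [/andP[e4 ste]|e_no] := boolP (_ && _).
  under eq_bigr do rewrite inE e4 ste andbT eq_sym.
  by rewrite -big_mkcond sum1_count count_uniq_mem // det_vals.
rewrite big1 // => a _; rewrite inE.
by case: ifP => // /andP[/andP[e4 _] ste]; rewrite e4 ste in e_no.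
Qed.

(** * Reduction from the bipartite matrix to 2 x 2 minors *)

Definition bipartite_mx (v : nat) (U : 'M[int]_v) : 'M[int]_(v + v) :=
  block_mx 0 U U^T 0.

Definition minor_sq (v : nat) (U : 'M[int]_v) x y b c : int :=
  (U x b * U y c - U x c * U y b) ^+ 2.

Lemma bipartite_mx_sym v (U : 'M[int]_v) : (bipartite_mx U)^T = bipartite_mx U.
Proof. by rewrite tr_block_mx !trmx0 trmxK. Qed.

Lemma bipartite_mx_hollow v (U : 'M[int]_v) i : bipartite_mx U i i = 0.
Proof.
by case: (split_ordP i) => j ->; rewrite ?block_mxEul ?block_mxEdr mxE.
Qed.

Ltac hollow_bipartite :=
  rewrite /hollow_det4 /minor_sq /bipartite_mx
    ?(block_mxEul, block_mxEur, block_mxEdl, block_mxEdr) ?mxE; ring.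

(** With both fixed indices on the row side, [hollow_det4] vanishes unless z and w are both columns,
    and then it is the squared minor. *)
Lemma edges_through_rows v (U : 'M[int]_v) (a : int) x y : a != 0 -> x != y ->
  2 * (edges_through (bipartite_mx U) a (lshift v x) (lshift v y))%:R
  = \sum_b \sum_c (minor_sq U x y b c == a)%:R :> int.
Proof.
move=> a0 xy; rewrite edges_through_hollow ?bipartite_mx_sym ?eq_lshift //; last first.
  exact: bipartite_mx_hollow.
have a0' : 0 == a = false by rewrite eq_sym (negPf a0).
rewrite big_split_ord /= big1 ?add0r => [|z _].
  apply: eq_bigr => b _; rewrite big_split_ord /= big1 ?add0r => [|w _].
    apply: eq_bigr => c _; congr (_ == a)%:R; hollow_bipartite.
  rewrite [hollow_det4 _ _ _ _ _](_ : _ = 0) ?a0' //; hollow_bipartite.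
rewrite big1 // => w _; case: (split_ordP w) => c ->;
  rewrite [hollow_det4 _ _ _ _ _](_ : _ = 0) ?a0' //; hollow_bipartite.
Qed.

Lemma edges_through_cols v (U : 'M[int]_v) (a : int) x y : a != 0 -> x != y ->
  2 * (edges_through (bipartite_mx U) a (rshift v x) (rshift v y))%:R
  = \sum_b \sum_c (minor_sq U^T x y b c == a)%:R :> int.
Proof.
move=> a0 xy; rewrite edges_through_hollow ?bipartite_mx_sym ?eq_rshift //; last first.
  exact: bipartite_mx_hollow.
have a0' : 0 == a = false by rewrite eq_sym (negPf a0).
rewrite big_split_ord /= [X in _ + X]big1 ?addr0 => [|z _].
  apply: eq_bigr => b _; rewrite big_split_ord /= [X in _ + X]big1 ?addr0 => [|w _].
    apply: eq_bigr => c _; congr (_ == a)%:R; hollow_bipartite.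
  rewrite [hollow_det4 _ _ _ _ _](_ : _ = 0) ?a0' //; hollow_bipartite.
rewrite big1 // => w _; case: (split_ordP w) => c ->;
  rewrite [hollow_det4 _ _ _ _ _](_ : _ = 0) ?a0' //; hollow_bipartite.
Qed.

(** Here z and w must lie on opposite sides. The two choices of side give equal sums, which absorbs
    the factor 2 of the ordered count. *)
Lemma edges_through_row_col v (U : 'M[int]_v) (a : int) x b : a != 0 ->
  (edges_through (bipartite_mx U) a (lshift v x) (rshift v b))%:R
  = \sum_y \sum_c (minor_sq U x y b c == a)%:R :> int.
Proof.
move=> a0; apply: (@mulfI _ 2) => //.
rewrite edges_through_hollow ?bipartite_mx_sym ?eq_lrshift //; last first.
  exact: bipartite_mx_hollow.
have a0' : 0 == a = false by rewrite eq_sym (negPf a0).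
rewrite big_split_ord /= mulr_natl mulr2n; congr (_ + _).
  apply: eq_bigr => y _; rewrite big_split_ord /= big1 ?add0r => [|w _].
    apply: eq_bigr => c _; congr (_ == a)%:R; hollow_bipartite.
  rewrite [hollow_det4 _ _ _ _ _](_ : _ = 0) ?a0' //; hollow_bipartite.
rewrite [RHS]exchange_big /=.
apply: eq_bigr => c _; rewrite big_split_ord /= [X in _ + X]big1 ?addr0 => [|w _].
  apply: eq_bigr => y _; congr (_ == a)%:R; hollow_bipartite.
rewrite [hollow_det4 _ _ _ _ _](_ : _ = 0) ?a0' //; hollow_bipartite.
Qed.

(** * Squared minors of matrices with entries 0, 1, -1 *)

Definition sign_mx v (U : 'M[int]_v) := forall x y, U x y \in [:: 0; 1; -1].

Lemma signP v (U : 'M[int]_v) : sign_mx U ->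
  forall x y, [\/ U x y = 0, U x y = 1 | U x y = -1].
Proof.
move=> U_sign x y; move: (U_sign x y); rewrite !inE.
by case/or3P => /eqP ->; [constructor 1 | constructor 2 | constructor 3].
Qed.

Lemma minor_sq_values v (U : 'M[int]_v) x y b c : sign_mx U ->
  minor_sq U x y b c \in [:: 0; 1; 4].
Proof.
move=> /signP U_sign; rewrite /minor_sq.
by case: (U_sign x b) => ->; case: (U_sign y c) => ->;
  case: (U_sign x c) => ->; case: (U_sign y b) => ->.
Qed.

(** There are sixteen distributions of the indices over the two sides. In the six balanced ones the
    first two arguments of [minor_sq] are the row indices; the others give 0. *)
Lemma hollow_det4_values v (U : 'M[int]_v) s t z w : sign_mx U ->
  hollow_det4 (bipartite_mx U) s t z w \in [:: 0; 1; 4].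
Proof.
move=> U_sign.
have v0 : (0 : int) \in [:: 0; 1; 4] by [].
case: (split_ordP s) => {}s ->; case: (split_ordP t) => {}t ->;
  case: (split_ordP z) => {}z ->; case: (split_ordP w) => {}w ->;
  first [ rewrite (_ : hollow_det4 _ _ _ _ _ = 0) //; hollow_bipartite
        | rewrite (_ : hollow_det4 _ _ _ _ _ = minor_sq U s t z w);
            [exact: minor_sq_values | hollow_bipartite]
        | rewrite (_ : hollow_det4 _ _ _ _ _ = minor_sq U s z t w);
            [exact: minor_sq_values | hollow_bipartite]
        | rewrite (_ : hollow_det4 _ _ _ _ _ = minor_sq U s w t z);
            [exact: minor_sq_values | hollow_bipartite]
        | rewrite (_ : hollow_det4 _ _ _ _ _ = minor_sq U t z s w);
            [exact: minor_sq_values | hollow_bipartite]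
        | rewrite (_ : hollow_det4 _ _ _ _ _ = minor_sq U t w s z);
            [exact: minor_sq_values | hollow_bipartite]
        | rewrite (_ : hollow_det4 _ _ _ _ _ = minor_sq U z w s t);
            [exact: minor_sq_values | hollow_bipartite] ].
Qed.

Lemma minor_sq_eq1 v (U : 'M[int]_v) x y b c : sign_mx U ->
  (minor_sq U x y b c == 1)%:R
  = U x b ^+ 2 * U y c ^+ 2 + U x c ^+ 2 * U y b ^+ 2
    - 2 * (U x b ^+ 2 * U y b ^+ 2 * (U x c ^+ 2 * U y c ^+ 2)) :> int.
Proof.
move=> /signP U_sign; rewrite /minor_sq.
by case: (U_sign x b) => ->; case: (U_sign y c) => ->;
  case: (U_sign x c) => ->; case: (U_sign y b) => ->.
Qed.

(** The products are grouped by column, b against c, so that each factor is a term of a Gram sum.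
    The factor 2 keeps the identity integral. *)
Lemma minor_sq_eq4 v (U : 'M[int]_v) x y b c : sign_mx U ->
  2 * (minor_sq U x y b c == 4)%:R
  = U x b ^+ 2 * U y b ^+ 2 * (U x c ^+ 2 * U y c ^+ 2)
    - U x b * U y b * (U x c * U y c) :> int.
Proof.
move=> /signP U_sign; rewrite /minor_sq.
by case: (U_sign x b) => ->; case: (U_sign y c) => ->;
  case: (U_sign x c) => ->; case: (U_sign y b) => ->.
Qed.

(** * Summing the indicators of minors *)

(** The relations are isolated from [is_BGW] so that they can be applied to [W] and to its
    transpose. The entrywise squares are the entries of N. *)
Record bgw_sums (v : nat) (d lam : int) (U : 'M[int]_v) : Prop := BGWSums {
  bgw_sign : sign_mx U;
  bgw_colsum : forall b, \sum_x U x b ^+ 2 = d;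
  bgw_gram : forall x y, \sum_b U x b * U y b = d * (x == y)%:R;
  bgw_gram_sq : forall x y,
    \sum_b U x b ^+ 2 * U y b ^+ 2 = lam + (d - lam) * (x == y)%:R }.

Lemma bgw_rowsum v d lam (U : 'M[int]_v) : bgw_sums d lam U ->
  forall x, \sum_b U x b ^+ 2 = d.
Proof.
move=> hU x; have := bgw_gram hU x x; rewrite eqxx mulr1 => <-.
by apply: eq_bigr => b _; rewrite expr2.
Qed.

Lemma sum_row_minors_eq1 v d lam (U : 'M[int]_v) : bgw_sums d lam U ->
  forall x y, x != y ->
  \sum_b \sum_c (minor_sq U x y b c == 1)%:R = 2 * (d ^+ 2 - lam ^+ 2) :> int.
Proof.
move=> hU x y xy; have rowd := bgw_rowsum hU.
transitivity (\sum_b (U x b ^+ 2 * d + U y b ^+ 2 * d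
                      - 2 * lam * (U x b ^+ 2 * U y b ^+ 2))).
  apply: eq_bigr => b _.
  under eq_bigr do rewrite (minor_sq_eq1 _ _ _ _ (bgw_sign hU)).
  rewrite sumrB big_split /= -!mulr_sumr -mulr_suml !rowd (bgw_gram_sq hU) (negPf xy) mulr0n.
  ring.
rewrite sumrB big_split /= -!mulr_sumr -!mulr_suml !rowd (bgw_gram_sq hU) (negPf xy) mulr0n.
ring.
Qed.

Lemma sum_row_minors_eq4 v d lam (U : 'M[int]_v) : bgw_sums d lam U ->
  forall x y, x != y ->
  2 * \sum_b \sum_c (minor_sq U x y b c == 4)%:R = lam ^+ 2 :> int.
Proof.
move=> hU x y xy; rewrite mulr_sumr.
transitivity (\sum_b lam * (U x b ^+ 2 * U y b ^+ 2)).
  apply: eq_bigr => b _; rewrite mulr_sumr.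
  under eq_bigr do rewrite (minor_sq_eq4 _ _ _ _ (bgw_sign hU)).
  rewrite sumrB /= -!mulr_sumr (bgw_gram_sq hU) (bgw_gram hU) (negPf xy) mulr0n.
  ring.
rewrite -mulr_sumr (bgw_gram_sq hU) (negPf xy) mulr0n.
ring.
Qed.

Lemma sum_entry_minors_eq1 v d lam (U : 'M[int]_v) : bgw_sums d lam U ->
  forall x b,
  \sum_y \sum_c (minor_sq U x y b c == 1)%:R
  = d ^+ 2 + U x b ^+ 2 * (d * v%:R - 2 * (lam * d) - 2 * (d - lam)) :> int.
Proof.
move=> hU x b; have rowd := bgw_rowsum hU.
(* The outer sum includes y = x, so the inner Gram sum keeps its Kronecker delta; the last term
   makes the contribution of y = x zero, as it must be for a minor with equal rows. *)
transitivity (\sum_y (U x b ^+ 2 * d + (d - 2 * (U x b ^+ 2 * lam)) * U y b ^+ 2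
                      - 2 * (d - lam) * (U x b ^+ 2 * ((x == y)%:R * U y b ^+ 2)))).
  apply: eq_bigr => y _.
  under eq_bigr do rewrite (minor_sq_eq1 _ _ _ _ (bgw_sign hU)).
  rewrite sumrB big_split /= -!mulr_sumr -mulr_suml !rowd (bgw_gram_sq hU).
  ring.
rewrite sumrB big_split /= -!mulr_sumr (bgw_colsum hU) sumr_const card_ord.
rewrite (bigD1 x) //= eqxx big1 => [|y]; last first.
  by rewrite eq_sym => /negPf ->; rewrite mul0r.
have -> : U x b ^+ 2 * (true%:R * U x b ^+ 2 + 0) = U x b ^+ 2.
  by case: (signP (bgw_sign hU) x b) => ->.
rewrite -mulr_natr; ring.
Qed.

Lemma sum_entry_minors_eq4 v d lam (U : 'M[int]_v) : bgw_sums d lam U ->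
  forall x b,
  2 * \sum_y \sum_c (minor_sq U x y b c == 4)%:R
  = U x b ^+ 2 * (lam * d - lam) :> int.
Proof.
move=> hU x b; have rowd := bgw_rowsum hU.
rewrite mulr_sumr.
transitivity (\sum_y (lam * U x b ^+ 2 * U y b ^+ 2
    + (x == y)%:R * ((d - lam) * (U x b ^+ 2 * U y b ^+ 2) - d * (U x b * U y b)))).
  apply: eq_bigr => y _; rewrite mulr_sumr.
  under eq_bigr do rewrite (minor_sq_eq4 _ _ _ _ (bgw_sign hU)).
  rewrite sumrB /= -!mulr_sumr (bgw_gram_sq hU) (bgw_gram hU).
  ring.
rewrite big_split /= -!mulr_sumr (bgw_colsum hU).
rewrite (bigD1 x) //= eqxx big1 => [|y]; last first.
  by rewrite eq_sym => /negPf ->; rewrite mul0r.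
by rewrite mulr1n; case: (signP (bgw_sign hU) x b) => ->; ring.
Qed.

(** * Dual Gram relations *)

(** By symmetry the diagonal entries of M^2 are the sums of squares along the rows of M, and M^2 = c
    M makes them 0. *)
Lemma sym_zero_diag_sqr (n : nat) (M : 'M[int]_n) (c : int) :
  M^T = M -> (forall i, M i i = 0) -> M *m M = c *: M -> M = 0.
Proof.
move=> M_sym M_diag M_sqr; apply/matrixP => i j; rewrite mxE.
have /eqP : \sum_k M i k ^+ 2 = 0.
  have := congr1 (fun A : 'M_n => A i i) M_sqr; rewrite !mxE M_diag mulr0 => M_sqr_ii.
  apply: etrans M_sqr_ii.
  by apply: eq_bigr => k _; rewrite expr2 -{2}M_sym mxE.
rewrite psumr_eq0 => [|k _]; last exact: sqr_ge0.
by move=> /allP/(_ j); rewrite mem_index_enum sqrf_eq0 => /(_ isT)/eqP.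
Qed.

Lemma gram_dual (n : nat) (W : 'M[int]_n) (d : int) :
  W *m W^T = d%:M -> (forall b, \sum_x W x b ^+ 2 = d) -> W^T *m W = d%:M.
Proof.
move=> WWT colsum; apply/eqP; rewrite -subr_eq0; apply/eqP.
(* With G = W^T W one has G^2 = d G, hence (G - d I)^2 = - d (G - d I). *)
apply: (@sym_zero_diag_sqr _ _ (- d)).
- by rewrite raddfB /= trmx_mul trmxK tr_scalar_mx.
- move=> i; rewrite !mxE eqxx mulr1n -(colsum i); apply/eqP; rewrite subr_eq0.
  by apply/eqP/eq_bigr => x _; rewrite mxE expr2.
have sqr : (W^T *m W) *m (W^T *m W) = d *: (W^T *m W).
  by rewrite mulmxA -(mulmxA W^T) WWT mul_mx_scalar -scalemxAl.
rewrite mulmxBr !mulmxBl sqr mul_scalar_mx !mul_mx_scalar.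
apply/matrixP => i j; move: (W^T *m W) => G; rewrite !mxE -mulr_natr.
ring.
Qed.

Lemma design_gram_dual (n : nat) (N : 'M[int]_n) (d lam : int) :
  (forall x, \sum_b N x b = d) -> (forall b, \sum_x N x b = d) ->
  (forall x y, N x y ^+ 2 = N x y) ->
  N *m N^T = (d - lam)%:M + const_mx lam ->
  N^T *m N = (d - lam)%:M + const_mx lam.
Proof.
move=> rowsum colsum N_idem NNT.
(* A row must exist to derive the parameter relation [d_lam], obtained by summing one row of N N^T
   in two ways. *)
case: n => [|n] in N rowsum colsum N_idem NNT *.
  by apply/matrixP => -[].
have d_lam : d ^+ 2 = (d - lam) + n.+1%:R * lam.
  transitivity (\sum_y (N *m N^T) ord0 y).
    under eq_bigr do rewrite mxE.
    rewrite exchange_big /=.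
    under eq_bigr do [under eq_bigr do rewrite mxE; rewrite -mulr_sumr colsum].
    by rewrite -mulr_suml rowsum expr2.
  rewrite NNT; under eq_bigr do rewrite !mxE.
  rewrite big_split /= sumr_const card_ord (bigD1 ord0) //= big1 ?addr0.
    by rewrite mulr1n mulr_natl.
  by move=> i /negPf; rewrite eq_sym => ->.
pose K : 'M[int]_n.+1 := const_mx 1.
have lamK : const_mx lam = lam *: K by apply/matrixP => i j; rewrite !mxE mulr1.
rewrite lamK in NNT *.
have NK : N *m K = d *: K.
  apply/matrixP => i j; rewrite !mxE mulr1 -(rowsum i).
  by apply: eq_bigr => k _; rewrite mxE mulr1.
have KN : K *m N = d *: K.
  apply/matrixP => i j; rewrite !mxE mulr1 -(colsum j).
  by apply: eq_bigr => k _; rewrite mxE mul1r.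
have KT : K^T = K by apply/matrixP => i j; rewrite !mxE.
have NTK : N^T *m K = d *: K by rewrite -{1}KT -trmx_mul KN linearZ /= KT.
have KNT : K *m N^T = d *: K by rewrite -{1}KT -trmx_mul NK linearZ /= KT.
have KK : K *m K = n.+1%:R *: K.
  apply/matrixP => i j; rewrite !mxE mulr1.
  under eq_bigr do rewrite !mxE mulr1.
  by rewrite sumr_const card_ord.
apply/eqP; rewrite -subr_eq0; apply/eqP.
(* The matrix M = G - (d - lam) I - lam K satisfies M^2 = - (d - lam) M: G^2 is found by
   substituting N N^T in the middle, and [d_lam] makes the coefficients of K agree. *)
apply: (@sym_zero_diag_sqr _ _ (- (d - lam))).
- by rewrite raddfB raddfD /= linearZ /= KT trmx_mul trmxK tr_scalar_mx.
- move=> i; rewrite !mxE eqxx mulr1n mulr1 subrK -(colsum i); apply/eqP.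
  by rewrite subr_eq0; apply/eqP/eq_bigr => x _; rewrite mxE -expr2 N_idem.
set G := N^T *m N.
have GG : G *m G = (d - lam) *: G + (lam * d ^+ 2) *: K.
  rewrite mulmxA -(mulmxA N^T) NNT mulmxDr mulmxDl mul_mx_scalar -scalemxAl.
  by rewrite -scalemxAr NTK -!scalemxAl KN !scalerA -mulrA.
have GK : G *m K = d ^+ 2 *: K by rewrite -mulmxA NK -scalemxAr NTK scalerA.
have KG : K *m G = d ^+ 2 *: K by rewrite mulmxA KNT -scalemxAl KN scalerA.
rewrite mulmxBr mulmxDr !mulmxBl !mulmxDl GG !mul_scalar_mx !mul_mx_scalar.
rewrite -!scalemxAl -!scalemxAr GK KG KK.
apply/matrixP => i j; move: d_lam; clear; move: G K => G K d_lam; rewrite !mxE.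
move: (G i j) (K i j) d_lam => g k; set m := n.+1%:R; move: m => m d_lam.
have -> : lam * d ^+ 2 = lam * (d - lam + m * lam) by rewrite d_lam.
have -> : d ^+ 2 = d - lam + m * lam by [].
rewrite -!(mulr_natr (d - lam)).
ring.
Qed.

(** * From the definition of a BGW matrix to its sum relations *)

Lemma unsign_mxE v (W : 'M[int]_v) : sign_mx W ->
  forall x y, unsign_mx W x y = W x y ^+ 2.
Proof. by move=> /signP W_sign x y; rewrite mxE; case: (W_sign x y) => ->. Qed.

Lemma design_incidence_gram (v n d lam : nat) (E : n.-tuple {set 'I_v}) :
  is_design 2 d lam E -> forall x y, x != y ->
  \sum_b incidence_mx E x b * incidence_mx E y b = lam%:R.
Proof.
case=> _ E_cnt x y xy; rewrite -(E_cnt [set x; y]); last by rewrite cards2 xy.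
rewrite -sum1_count big_tuple natr_sum [RHS]big_mkcond /=.
apply: eq_bigr => b _; rewrite !mxE -natrM mulnb subUset !sub1set.
by case: (_ && _).
Qed.

Lemma design_incidence_colsum (v n d lam t : nat) (E : n.-tuple {set 'I_v}) :
  is_design t d lam E -> forall b, \sum_x incidence_mx E x b = d%:R.
Proof.
case=> E_card _ b; rewrite -(E_card (tnth E b)) ?mem_tnth // -sum1_card natr_sum.
by rewrite [RHS]big_mkcond; apply: eq_bigr => x _; rewrite mxE; case: (_ \in _).
Qed.

(** For [W], the design gives the column sums and the off-diagonal squared Gram sums, and W W^T
    gives the rest. For the transpose, rows and columns exchange roles and the two dual Gram lemmas
    supply the products. *)
Lemma is_BGW_sums v d lam (W : 'M[int]_v) : is_BGW d lam W ->
  bgw_sums d%:R lam%:R W /\ bgw_sums d%:R lam%:R W^T.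
Proof.
case=> _ W_sign WWT [E E_des WE].
have colsum b : \sum_x W x b ^+ 2 = d%:R.
  rewrite -(design_incidence_colsum E_des b) -WE.
  by apply: eq_bigr => x _; rewrite unsign_mxE.
have gram x y : \sum_b W x b * W y b = d%:R * (x == y)%:R.
  have := congr1 (fun A : 'M_v => A x y) WWT; rewrite !mxE -(mulr_natr d%:R) => <-.
  by apply: eq_bigr => b _; rewrite mxE.
have rowsum x : \sum_b W x b ^+ 2 = d%:R.
  have := gram x x; rewrite eqxx mulr1 => <-.
  by apply: eq_bigr => b _; rewrite expr2.
have sqr_idem x y : (W x y ^+ 2) ^+ 2 = W x y ^+ 2.
  by case: (signP W_sign x y) => ->.
have gram_sq x y : \sum_b W x b ^+ 2 * W y b ^+ 2
                   = lam%:R + (d%:R - lam%:R) * (x == y)%:R.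
  have [<-|xy] := eqVneq x y.
    rewrite mulr1 addrC subrK -(rowsum x); apply: eq_bigr => b _.
    by rewrite -expr2 sqr_idem.
  rewrite mulr0 addr0 -(design_incidence_gram E_des xy) -WE.
  by apply: eq_bigr => b _; rewrite !unsign_mxE.
split; split => //.
- by move=> x y; rewrite mxE.
- by move=> x; rewrite -(rowsum x); apply: eq_bigr => b _; rewrite mxE.
- move=> x y; have := gram_dual WWT colsum => /(congr1 (fun A : 'M_v => A x y)).
  by rewrite !mxE -(mulr_natr d%:R) => <-; apply: eq_bigr => b _; rewrite !mxE.
pose N : 'M[int]_v := map_mx (fun w => w ^+ 2) W.
have NE x y : N x y = W x y ^+ 2 by rewrite mxE.
have NTN : N^T *m N = (d%:R - lam%:R)%:M + const_mx lam%:R.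
  apply: design_gram_dual => [x|b|x y|].
  - by rewrite -(rowsum x); apply: eq_bigr => b _.
  - by rewrite -(colsum b); apply: eq_bigr => x _.
  - by rewrite NE sqr_idem.
  apply/matrixP => x y; rewrite !mxE addrC -(mulr_natr (_ - _)) -gram_sq.
  by apply: eq_bigr => b _; rewrite !mxE.
move=> x y; have := congr1 (fun A : 'M_v => A x y) NTN.
rewrite !mxE addrC -(mulr_natr (_ - _)) => <-.
by apply: eq_bigr => b _; rewrite !mxE.
Qed.

(** * Regularity from pair counts on an association scheme *)

Lemma count_enum (T : finType) (H : {set T}) (P : pred T) :
  count P (enum H) = #|[set e in H | P e]|.
Proof. by rewrite -sum1_count big_enum_cond -sum1dep_card. Qed.

(* Double counting flags (y, e) with x, y in e expresses (k - 1) deg x through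
   the valencies and the pair parameters, neither of which depends on x. *)
Lemma scheme_pair_count_1design (m c k : nat) (R : 'I_c.+1 -> rel 'I_m)
    (H : {set {set 'I_m}}) (mu : 'I_c -> rat) :
  is_symmetric_scheme R -> (1 < k)%N -> (forall e, e \in H -> #|e| = k) ->
  (forall i x y, R (lift ord0 i) x y ->
     #|[set e in H | [set x; y] \subset e]|%:R = mu i) ->
  exists r, is_design 1 k r (enum H).
Proof.
case=> R0 R_part R_sym [p Rp] k_gt1 H_k H_mu.
pose deg x := #|[set e in H | x \in e]|.
have valency i x : #|[set z | R i x z]| = p i i ord0.
  rewrite -(Rp i i ord0 x x) ?R0 //; apply: eq_card => z.
  by rewrite !inE (R_sym i z x) andbb.
have deg_k x : (deg x)%:R * (k.-1)%:R = \sum_i mu i * (p (lift ord0 i) (lift ord0 i) ord0)%:R.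
  transitivity (\sum_(y | y != x) #|[set e in H | [set x; y] \subset e]|%:R : rat).
    rewrite -natr_sum -natrM; congr _%:R.
    under [RHS]eq_bigr do rewrite -sum1dep_card.
    rewrite (exchange_big_dep (fun e => (e \in H) && (x \in e))) /=; last first.
      by move=> y e _ /andP[-> ]; rewrite subUset !sub1set => /andP[].
    rewrite -sum_nat_const.
    rewrite [LHS](eq_bigl (fun e => (e \in H) && (x \in e))); last by move=> e; rewrite inE.
    apply: eq_bigr => e /andP[eH xe]; rewrite sum1dep_card -(H_k e eH).
    rewrite (cardsD1 x) xe /=; apply: eq_card => y.
    by rewrite !inE eH subUset !sub1set xe.
  transitivity (\sum_(y | y != x) \sum_i mu i * (R (lift ord0 i) x y)%:R).
    apply: eq_bigr => y yx.
    have [j [Rj j_uniq]] := R_part x y.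
    case: (unliftP ord0 j) Rj j_uniq => [i ->|->] Rj j_uniq; last first.
      by move: Rj; rewrite R0 eq_sym (negPf yx).
    rewrite (bigD1 i) //= Rj mulr1 big1 ?addr0 ?(H_mu i) // => l li.
    case Rl: (R _ _ _); last by rewrite mulr0.
    by have /lift_inj il := j_uniq _ Rl; rewrite il eqxx in li.
  rewrite exchange_big /=; apply: eq_bigr => i _.
  rewrite -mulr_sumr -(valency _ x) -natr_sum -sum1dep_card; congr (_ * _%:R).
  rewrite [RHS]big_mkcond [RHS](bigD1 x) //= (_ : R _ x x = false) ?add0n.
    by apply: eq_bigr => y _; case: (R _ _ _).
  apply/negP => Rx; have [j [Rj j_uniq]] := R_part x x.
  have j0 : j = ord0 by apply: j_uniq; rewrite R0.
  by have := j_uniq _ Rx; rewrite j0.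
have deg_const x y : deg x = deg y.
  have k1 : (k.-1)%:R != 0 :> rat by rewrite pnatr_eq0 -lt0n -subn1 subn_gt0.
  by apply/eqP; rewrite -(eqr_nat rat) -(inj_eq (mulIf k1)) !deg_k.
(* The default 0 is for m = 0, where there is no singleton to test. *)
exists (if [pick x : 'I_m] is Some x then deg x else 0%N); split=> [e|S].
  by rewrite mem_enum => /H_k.
move=> /eqP/cards1P[x ->]; rewrite count_enum.
case: pickP => [y _|/(_ x)//]; rewrite -(deg_const x); apply: eq_card => e.
by rewrite !inE sub1set.
Qed.

(** * The association scheme [X2] *)

Definition X2_class v (N : 'M[int]_v) (x y : 'I_(v + v)) : 'I_4 :=
  match split x, split y with
  | inl x, inl y | inr x, inr y =>
      if x == y then @Ordinal 4 0 isT else @Ordinal 4 2 isT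
  | inl x, inr b | inr b, inl x =>
      if N x b == 1 then @Ordinal 4 1 isT else @Ordinal 4 3 isT
  end.

(** The general element of the Bose-Mesner algebra, in the basis I, I_2 (x) J, A_1, A_1 + A_3 rather
    than A_0, ..., A_3; block products are simpler in these coordinates. *)
Definition X2_comb v (N : 'M[int]_v) (a b c e : int) : 'M[int]_(v + v) :=
  let K : 'M[int]_v := const_mx 1 in
  block_mx (a%:M + b *: K) (c *: N + e *: K) (c *: N^T + e *: K) (a%:M + b *: K).

Lemma X2_combE v (N : 'M[int]_v) a b c e x y :
  (forall x y, N x y \in [:: 0; 1]) ->
  X2_comb N a b c e x y = nth 0 [:: a + b; c + e; b; e] (X2_class N x y).
Proof.
move=> N01; have NP z w : N z w = 0 \/ N z w = 1.
  by have := N01 z w; rewrite !inE => /orP[] /eqP; [left | right].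
rewrite /X2_class /X2_comb.
case: (split_ordP x) => {}x ->; case: (split_ordP y) => {}y ->;
  rewrite ?split_lshift ?split_rshift ?eq_lshift ?eq_rshift
    ?(block_mxEul, block_mxEur, block_mxEdl, block_mxEdr) !mxE.
- by case: eqVneq => _ /=; ring.
- by case: (NP x y) => -> /=; ring.
- by case: (NP y x) => -> /=; ring.
- by case: eqVneq => _ /=; ring.
Qed.

Lemma X2_mx_comb v (N : 'M[int]_v) (i : 'I_4) :
  X2_mx N i = X2_comb N (nth 0 [:: 1; 0; -1; 0] i) (nth 0 [:: 0; 0; 1; 0] i)
                        (nth 0 [:: 0; 1; 0; -1] i) (nth 0 [:: 0; 0; 0; 1] i).
Proof.
rewrite /X2_mx /X2_comb; case: i => [[|[|[|[|//]]]]] _ /=;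
  rewrite !(scale0r, scale1r, scaleN1r, addr0, add0r, raddfN, raddf0) //=.
- by rewrite scalar_mx_block.
- by rewrite addrC.
- by congr block_mx; rewrite addrC.
Qed.

Lemma X2E v (N : 'M[int]_v) i x y : (forall x y, N x y \in [:: 0; 1]) ->
  X2 N i x y = (i == X2_class N x y).
Proof.
move=> N01; rewrite /X2 X2_mx_comb X2_combE //.
by case: (X2_class N x y) => [[|[|[|[|//]]]]] hj; case: i => [[|[|[|[|//]]]]] hi.
Qed.

Lemma X2_mxE v (N : 'M[int]_v) i x y : (forall x y, N x y \in [:: 0; 1]) ->
  X2_mx N i x y = (X2 N i x y)%:R.
Proof.
move=> N01; rewrite /X2 X2_mx_comb X2_combE //.
by case: (X2_class N x y) => [[|[|[|[|//]]]]] hj; case: i => [[|[|[|[|//]]]]] hi.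
Qed.

Lemma X2_classC v (N : 'M[int]_v) x y : X2_class N x y = X2_class N y x.
Proof.
by rewrite /X2_class; case: (split x) => x'; case: (split y) => y' //; rewrite eq_sym.
Qed.

Lemma X2_class0 v (N : 'M[int]_v) x y : (ord0 == X2_class N x y) = (x == y).
Proof.
rewrite /X2_class; case: (split_ordP x) => x' Dx; case: (split_ordP y) => y' Dy.
- by rewrite Dx Dy eq_lshift; case: ifP.
- by rewrite Dx Dy eq_lrshift; case: ifP.
- by rewrite Dx Dy eq_rlshift; case: ifP.
- by rewrite Dx Dy eq_rshift; case: ifP.
Qed.

(** Closure of the algebra under products. It yields the intersection numbers, since an entry of an
    [X2_comb] depends only on the class of its position. *)
Lemma X2_comb_mul v (N : 'M[int]_v) (d lam : int) a b c e a' b' c' e' :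
  let K : 'M[int]_v := const_mx 1 in
  N *m K = d *: K -> K *m N = d *: K ->
  N *m N^T = (d - lam)%:M + lam *: K -> N^T *m N = (d - lam)%:M + lam *: K ->
  X2_comb N a b c e *m X2_comb N a' b' c' e'
  = X2_comb N (a * a' + c * c' * (d - lam))
      (a * b' + b * a' + b * b' * v%:R + c * c' * lam + (c * e' + e * c') * d + e * e' * v%:R)
      (a * c' + c * a')
      (a * e' + b * c' * d + b * e' * v%:R + c * b' * d + e * a' + e * b' * v%:R).
Proof.
move=> K NK KN NNT NTN.
have KT : K^T = K by apply/matrixP => i j; rewrite !mxE.
have NTK : N^T *m K = d *: K by rewrite -{1}KT -trmx_mul KN linearZ /= KT.
have KNT : K *m N^T = d *: K by rewrite -{1}KT -trmx_mul NK linearZ /= KT.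
have KK : K *m K = v%:R *: K.
  apply/matrixP => i j; rewrite !mxE mulr1.
  under eq_bigr do rewrite !mxE mulr1.
  by rewrite sumr_const card_ord.
rewrite /X2_comb -/K mulmx_block; congr block_mx.
all: rewrite !(mulmxDl, mulmxDr) -!(scalemxAl, scalemxAr) !(mul_scalar_mx, mul_mx_scalar).
- rewrite NNT NK KNT KK; generalize K => L.
  apply/matrixP => i j; rewrite !mxE.
  by generalize (L i j) (v%:R : int) => l n; case: (i == j); rewrite ?mulr0n ?mulr1n; ring.
- rewrite NK KN KK; generalize K => L.
  apply/matrixP => i j; rewrite !mxE.
  by generalize (L i j) (v%:R : int) => l n; ring.
- rewrite NTK KNT KK; generalize N^T K => M L.
  apply/matrixP => i j; rewrite !mxE.
  by generalize (M i j) (L i j) (v%:R : int) => m l n; ring.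
- rewrite NTN KN NTK KK; generalize K => L.
  apply/matrixP => i j; rewrite !mxE.
  by generalize (L i j) (v%:R : int) => l n; case: (i == j); rewrite ?mulr0n ?mulr1n; ring.
Qed.

Lemma X2_scheme v (N : 'M[int]_v) (d lam : int) :
  let K : 'M[int]_v := const_mx 1 in
  (forall x y, N x y \in [:: 0; 1]) ->
  N *m K = d *: K -> K *m N = d *: K ->
  N *m N^T = (d - lam)%:M + lam *: K -> N^T *m N = (d - lam)%:M + lam *: K ->
  is_symmetric_scheme (X2 N).
Proof.
move=> K N01 NK KN NNT NTN; split=> [x y|x y|i x y|].
- by rewrite X2E // X2_class0.
- exists (X2_class N x y); split; first by rewrite X2E.
  by move=> i; rewrite X2E // => /eqP.
- by rewrite !X2E // X2_classC.
have mulE i j x y : #|[set z | X2 N i x z && X2 N j z y]|%:R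
                    = (X2_mx N i *m X2_mx N j) x y.
  rewrite -sum1dep_card natr_sum big_mkcond mxE; apply: eq_bigr => z _.
  by rewrite !X2_mxE //; case: (X2 N i x z); case: (X2 N j z y).
(* The intersection number is read off at an arbitrary pair of R_k, with default 0 when R_k is
   empty. *)
exists (fun i j k => if [pick xy : _ * _ | X2 N k xy.1 xy.2] is Some xy
                     then #|[set z | X2 N i xy.1 z && X2 N j z xy.2]| else 0%N).
move=> i j k x y kxy; case: pickP => [[x' y'] /= kxy'|/(_ (x, y))]; last by rewrite kxy.
apply/eqP; rewrite -(eqr_nat int) !mulE !X2_mx_comb (X2_comb_mul _ _ _ _ _ _ _ _ NK KN NNT NTN).
rewrite !X2_combE //.
by move: kxy kxy'; rewrite !X2E // => /eqP <- /eqP <-.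
Qed.

Lemma bgw_X2_scheme v d lam (W : 'M[int]_v) :
  bgw_sums d lam W -> bgw_sums d lam W^T -> is_symmetric_scheme (X2 (unsign_mx W)).
Proof.
move=> hW hWT; have NE := unsign_mxE (bgw_sign hW).
have NTE x y : (unsign_mx W)^T x y = W^T x y ^+ 2 by rewrite [LHS]mxE NE mxE.
apply: (@X2_scheme _ _ d lam).
- by move=> x y; rewrite NE; case: (signP (bgw_sign hW) x y) => ->.
- apply/matrixP => x y; rewrite !mxE mulr1 -(bgw_rowsum hW x).
  by apply: eq_bigr => b _; rewrite NE mxE mulr1.
- apply/matrixP => x y; rewrite !mxE mulr1 -(bgw_colsum hW y).
  by apply: eq_bigr => b _; rewrite NE mxE mul1r.
- apply/matrixP => x y; rewrite !mxE mulr1 addrC -(mulr_natr (_ - _)).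
  by rewrite -(bgw_gram_sq hW); apply: eq_bigr => b _; rewrite !NE mxE NE.
- apply/matrixP => x y; rewrite !mxE mulr1 addrC -(mulr_natr (_ - _)).
  by rewrite -(bgw_gram_sq hWT); apply: eq_bigr => b _; rewrite NTE NE !mxE.
Qed.

(** * Pair counts for determinants 1 and 4, and the conclusion *)

(** The entries are the numbers of 4-sets of determinant 1 through a pair in R_1, R_2, R_3 in turn;
    [pairs_det4] is the analogue for determinant 4. *)
Definition pairs_det1 (v d lam : rat) : seq rat :=
  [:: d ^+ 2 + d * (v - 2) - 2 * lam * (d - 1); d ^+ 2 - lam ^+ 2; d ^+ 2].

Definition pairs_det4 (d lam : rat) : seq rat :=
  [:: lam * (d - 1) / 2; lam ^+ 2 / 4; 0].

Lemma bgw_edges_row_col v (d lam : nat) (W : 'M[int]_v) :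
  bgw_sums d%:R lam%:R W -> forall x b,
  let i := if unsign_mx W x b == 1 then 0%N else 2%N in
  (edges_through (bipartite_mx W) 1 (lshift v x) (rshift v b))%:R
    = nth 0 (pairs_det1 v%:R d%:R lam%:R) i
  /\ (edges_through (bipartite_mx W) 4 (lshift v x) (rshift v b))%:R
    = nth 0 (pairs_det4 d%:R lam%:R) i.
Proof.
move=> hW x b; rewrite unsign_mxE; last exact: bgw_sign hW.
have e1 := sum_entry_minors_eq1 hW x b.
have e4 := sum_entry_minors_eq4 hW x b.
rewrite -edges_through_row_col // in e1; rewrite -edges_through_row_col // in e4.
move/(congr1 (fun z : int => z%:~R : rat)): e1.
move/(congr1 (fun z : int => z%:~R : rat)): e4.
have : W x b ^+ 2 = 0 \/ W x b ^+ 2 = 1.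
  by case: (signP (bgw_sign hW) x b) => ->; [left | right | right].
case=> -> /=; rewrite !(rmorphD, rmorphB, rmorphM, rmorphXn, rmorph_nat) /= => e4 e1;
  split; lra.
Qed.

Lemma bgw_edges_rows v (d lam : nat) (W : 'M[int]_v) :
  bgw_sums d%:R lam%:R W -> forall x y, x != y ->
  (edges_through (bipartite_mx W) 1 (lshift v x) (lshift v y))%:R
    = nth 0 (pairs_det1 v%:R d%:R lam%:R) 1
  /\ (edges_through (bipartite_mx W) 4 (lshift v x) (lshift v y))%:R
    = nth 0 (pairs_det4 d%:R lam%:R) 1.
Proof.
move=> hW x y xy.
have e1 := sum_row_minors_eq1 hW xy; have e4 := sum_row_minors_eq4 hW xy.
rewrite -edges_through_rows // in e1; rewrite -edges_through_rows // in e4.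
(* Over the rationals the doublings can be undone: one comes from ordered pairs and, for determinant
   4, another from [minor_sq_eq4], whence lam^2 / 4. *)
move/(congr1 (fun z : int => z%:~R : rat)): e1.
move/(congr1 (fun z : int => z%:~R : rat)): e4.
rewrite !(rmorphD, rmorphB, rmorphM, rmorphXn, rmorph_nat) /= => e4 e1.
split; lra.
Qed.

Lemma bgw_edges_cols v (d lam : nat) (W : 'M[int]_v) :
  bgw_sums d%:R lam%:R W^T -> forall x y, x != y ->
  (edges_through (bipartite_mx W) 1 (rshift v x) (rshift v y))%:R
    = nth 0 (pairs_det1 v%:R d%:R lam%:R) 1
  /\ (edges_through (bipartite_mx W) 4 (rshift v x) (rshift v y))%:R
    = nth 0 (pairs_det4 d%:R lam%:R) 1.
Proof.
move=> hWT x y xy.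
have e1 := sum_row_minors_eq1 hWT xy; have e4 := sum_row_minors_eq4 hWT xy.
rewrite -edges_through_cols // in e1; rewrite -edges_through_cols // in e4.
move/(congr1 (fun z : int => z%:~R : rat)): e1.
move/(congr1 (fun z : int => z%:~R : rat)): e4.
rewrite !(rmorphD, rmorphB, rmorphM, rmorphXn, rmorph_nat) /= => e4 e1.
split; lra.
Qed.

Lemma bgw_edges_through v (d lam : nat) (W : 'M[int]_v) :
  bgw_sums d%:R lam%:R W -> bgw_sums d%:R lam%:R W^T ->
  forall (i : 'I_3) s t, X2 (unsign_mx W) (lift ord0 i) s t ->
  [/\ s != t,
      (edges_through (bipartite_mx W) 1 s t)%:R = nth 0 (pairs_det1 v%:R d%:R lam%:R) i
    & (edges_through (bipartite_mx W) 4 s t)%:R = nth 0 (pairs_det4 d%:R lam%:R) i].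
Proof.
move=> hW hWT i s t; have NE := unsign_mxE (bgw_sign hW).
rewrite X2E => [|x y]; last first.
  by rewrite NE; case: (signP (bgw_sign hW) x y) => ->.
move=> /eqP st_class; have st : s != t.
  by rewrite -(X2_class0 (unsign_mx W)) -st_class.
(* The parameter lists start at R_1, so their index is the class minus one. *)
have {st_class} := congr1 (fun k : 'I_4 => k.-1) st_class; rewrite lift0 /= => ->.
move: st; rewrite /X2_class.
case: (split_ordP s) => x ->; case: (split_ordP t) => y ->;
  rewrite ?eq_lshift ?eq_rshift => st.
- rewrite (negPf st); have [-> ->] := bgw_edges_rows hW st; by [].
- by have [-> ->] := bgw_edges_row_col hW x y; case: ifP.
- rewrite ![edges_through _ _ (rshift _ _) _]edges_throughC.
  by have [-> ->] := bgw_edges_row_col hW y x; case: ifP; rewrite eq_rlshift.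
- by rewrite (negPf st); have [-> ->] := bgw_edges_cols hWT st.
Qed.

Theorem theorem3p12 (v d lam : nat) (W : 'M[int]_v) (a : int)
    (hv : (2 <= v)%N) (hW : is_BGW d lam W) (ha : a = 0 \/ a = 1) :
  let A : 'M[int]_(v + v) := block_mx 0 W W^T 0 in
  let aq : rat := a%:~R in
  let vq : rat := v%:R in
  let dq : rat := d%:R in
  let lq : rat := lam%:R in
  (* number of 4-subsets containing a given pair; the source prints
     'C(2 * v, 4), which makes the case a = 0 false for every v >= 3 *)
  let T : rat := 'C(2 * v - 2, 2)%:R in
  is_PBIBD 4
    ((1 - aq) * (T - lq * (dq - 1) / 2)
      + (2 * aq - 1) * (dq ^+ 2 + dq * (vq - 2) - 2 * lq * (dq - 1)))
    ((1 - aq) * (T - lq ^+ 2 / 4) + (2 * aq - 1) * (dq ^+ 2 - lq ^+ 2))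
    ((1 - aq) * T + (2 * aq - 1) * dq ^+ 2)
    (X2 (unsign_mx W)) (det_hypergraph A 4 a).
Proof.
have [hWs hWTs] := is_BGW_sums hW; move=> A aq vq dq lq T.
have scheme := bgw_X2_scheme hWs hWTs.
set lam1 := (X in is_PBIBD 4 X); set lam2 := (X in is_PBIBD 4 _ X).
set lam3 := (X in is_PBIBD 4 _ _ X).
have pairs (i : 'I_3) s t : X2 (unsign_mx W) (lift ord0 i) s t ->
    (edges_through A a s t)%:R = nth 0 [:: lam1; lam2; lam3] i.
  move=> /(bgw_edges_through hWs hWTs)[st e1 e4].
  (* The counts for determinants 0, 1 and 4 add up to [T]. This settles a = 0, while a = 1 is [e1]
     itself. *)
  have := edges_through_total (bipartite_mx_sym W) (bipartite_mx_hollow W) st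
    (_ : uniq [:: 0; 1; 4]) (fun z w => hollow_det4_values s t z w (bgw_sign hWs)).
  move=> /(_ isT)/(congr1 (fun n : nat => n%:R : rat)).
  rewrite (_ : 'C(_, 2)%:R = T); last by rewrite /T mul2n addnn.
  rewrite !big_cons big_nil addn0 !natrD e1 e4.
  rewrite /lam1 /lam2 /lam3 /aq.
  case: ha => ->; last first.
    by rewrite e1 => _; case: i {e1 e4} => [[|[|[|//]]]] _ /=; rewrite /vq /dq /lq; ring.
  by case: i {e1 e4} => [[|[|[|//]]]] _ /=; rewrite /vq /dq /lq => e0; lra.
split=> //.
apply: (scheme_pair_count_1design scheme _ _ pairs) => // e.
by rewrite inE => /andP[/eqP].
Qed.
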